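(* Let $\mathcal{C}$ be a finite constraint system over variables $\mathcal{V}$ with values in $\mathbb{F}_p$, let $\sigma^\star$ be the analysis fixpoint for $\mathcal{C}$, and let $G=(F\cup N,E)$ be the provenance graph of $\mathcal{C}$ at $\sigma^\star$. Assume that every transfer function $\mathrm{transfer}_c$ ($c\in\mathcal{C}$) is monotone and locally sound, and that the entailment rules are entailment-sound: for every entailed constraint $c\in\mathcal{C}$ and every witness $w$ satisfying every fact in $\mathrm{Obl}(c)$, we have $w\models c$. If $\mathcal{R}\subseteq\mathcal{C}$ is provenance-grounded, then $\mathcal{R}$ is a safe debloating of $\mathcal{C}$, i.e. $\mathcal{C}\setminus\mathcal{R}\vdash\mathcal{R}$; equivalently, every witness $w:\mathcal{V}\to\mathbb{F}_p$ satisfies $\mathcal{C}\setminus\mathcal{R}$ if and only if it satisfies $\mathcal{C}$.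
   Context: **Constraint systems.** $p$ is an odd prime, $\mathcal{V}$ a finite set of variables, and $\mathcal{C}$ a finite set of constraints, each constraint $c$ being a condition (polynomial equation, table lookup, or equality of two variables) on assignments that depends only on a finite set $\mathrm{vars}(c)\subseteq\mathcal{V}$. A witness is a map $w:\mathcal{V}\to\mathbb{F}_p$; $w\models c$ means $c$ holds under $w$, and $w\models\Gamma$ means $w\models c$ for all $c\in\Gamma$. For sets $\Gamma,\Phi$ of constraints, $\Gamma\vdash\Phi$ means that every witness satisfying $\Gamma$ satisfies every $c\in\Phi$. $\mathcal{R}\subseteq\mathcal{C}$ is a *safe debloating* of $\mathcal{C}$ if $\mathcal{C}\setminus\mathcal{R}\vdash\mathcal{R}$. **Abstract states.** Field elements are read as integers through their canonical signed representative in $W=[-(p-1)/2,(p-1)/2]$. An abstract value describes a set of field elements via a concretization $\gamma$; abstract values form the reduced product of three lattices: constants (a known field element or $\top$), integer intervals $[\ell,u]$, and known bits (a bitmask $m$ and pattern $b$, asserting that bit $i$ of the value equals $b_i$ whenever $m_i=1$). They are ordered by $\sqsubseteq$ (more precise is smaller), and $\top$ describes all of $\mathbb{F}_p$. An abstract state $\sigma$ assigns an abstract value $\sigma(v)$ to each $v\in\mathcal{V}$; it over-approximates $w$ if $w(v)\in\gamma(\sigma(v))$ for all $v$. Each $c\in\mathcal{C}$ has a transfer function $\mathrm{transfer}_c$ from states to states. It is *monotone* if $\sigma_1\sqsubseteq\sigma_2$ implies $\mathrm{transfer}_c(\sigma_1)\sqsubseteq\mathrm{transfer}_c(\sigma_2)$,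 and *locally sound* if for every $w\models c$ and every state $\sigma$ over-approximating $w$, $\mathrm{transfer}_c(\sigma)$ over-approximates $w$. The fixpoint $\sigma^\star$ is the state reached by repeatedly applying the transfer functions of all $c\in\mathcal{C}$ until stabilization, starting from the state that maps each variable to $\top$, except variables pinned to circuit constants, which start at that constant. **Facts.** Let $\mathcal{K}=\{\mathit{lo},\mathit{hi},\mathit{bits}\}$. The fact $(v,k)$ is the corresponding atom recorded by $\sigma^\star(v)$: the lower bound $v\ge\ell$, the upper bound $v\le u$, or the known-bits pattern of $v$. A witness satisfies $(v,k)$ if $w(v)$ satisfies this atom. For a state $\sigma$, $\sigma(v)\Vdash(v,k)$ means that every element of $\gamma(\sigma(v))$ satisfies the atom $(v,k)$. $F$ is the set of facts $(v,k)$ with $\sigma^\star(v)\Vdash(v,k)$. **Provenance graph.** For $v\in\mathcal{V}$ and $S\subseteq F$, let $\mathit{state}_v(S)$ be the state mapping $v$ to $\top$ and each other variable $u$ to the narrowest abstract value consistent with the facts about $u$ in $S$, i.e. the most precise abstract value whose concretization contains all field elements satisfying those facts ($\top$ if there are none). $N$ is a set of constraint nodes $(c,f,P)$ with $c\in\mathcal{C}$, target $f=(v,k)\in F$ where $v\in\mathrm{vars}(c)$, and premise set $P\subseteq F$ of facts about variables in $\mathrm{vars}(c)\setminus\{v\}$. The nodes are generated as follows: for each $c$, $v\in\mathrm{vars}(c)$ and $k\in\mathcal{K}$ with $\mathrm{transfer}_c(\sigma^\star[v\mapsto\top])(v)\Vdash(v,k)$, one node $(c,(v,k),P)$ is added,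 where $P$ satisfies $\mathrm{transfer}_c(\mathit{state}_v(P))(v)\Vdash(v,k)$ and is irreducible (obtained by starting from all facts of $F$ about variables in $\mathrm{vars}(c)\setminus\{v\}$ and dropping facts one at a time as long as this property is kept). $E$ consists of an edge $p\to\nu$ for each premise $p\in P$ and an edge $\nu\to f$, for each $\nu=(c,f,P)\in N$. **Provability under a mask.** A mask is a subset $M\subseteq N$. Provability under $M$ is the least fixed point of: a node $(c,f,P)\in N\setminus M$ is provable iff every $q\in P$ is provable; a fact $f$ is provable iff some provable node in $N\setminus M$ has target $f$. (So a provable fact has a finite acyclic derivation rooted at nodes with $P=\emptyset$.) For $R\subseteq\mathcal{C}$, put $M_R=\{(c,f,P)\in N: c\in R\}$. **Entailment rules and obligations.** A family of rules, by constraint shape, declares certain constraints $c\in\mathcal{C}$ to be *entailed* by $\sigma^\star$, and assigns to each entailed $c$ a set $\mathrm{Obl}(c)\subseteq F$ of obligations (the facts the rule consulted). Representative rules: a lookup $v\in T$, where $T$ consists of exactly the integers in $[t_\ell,t_u]$, is entailed when $\sigma^\star(v)\Vdash v\in[t_\ell,t_u]$, with $\mathrm{Obl}(c)=\{(v,\mathit{lo}),(v,\mathit{hi})\}$; a gate $e(\vec v)=0$ is entailed when $\sigma^\star(v_i)=\{a_i\}$ for all $i$ and $e(\vec a)=0$, with $\mathrm{Obl}(c)$ the $\mathit{lo}$ and $\mathit{hi}$ facts of all $v_i$. Constraints of shapes matching no rule are not entailed. The only property of the rules that is assumed is the entailment soundness stated in the claim. **Provenance-grounded.** $\mathcal{R}\subseteq\mathcal{C}$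 is provenance-grounded if its elements can be ordered $c_1,\dots,c_k$ so that each $c_i$ is entailed and, with $\mathcal{R}_i=\{c_1,\dots,c_i\}$, every fact in $\mathrm{Obl}(c_i)$ is provable in $G$ under the mask $M_{\mathcal{R}_i}$, for every $i\in\{1,\dots,k\}$. *)

(* Defs.v *)
From HB Require Import structures.
From mathcomp Require Import all_boot all_order all_algebra.
From mathcomp Require Import mpoly.

Set Implicit Arguments.
Unset Strict Implicit.
Unset Printing Implicit Defensive.

Import Order.TTheory GRing.Theory Num.Theory.
Local Open Scope ring_scope.

(* A polynomial equation is a polynomial over the #|V| variables enumerated by
   [enum_val]; a lookup asserts that the row of values of [vs] is in table [T]. *)
Inductive condition (p : nat) (V : finType) : Type :=
| PolyEq of {mpoly 'F_p[#|V|]}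
| Lookup (vs : seq V) (T : seq (seq 'F_p))
| VarEq (x y : V).

Definition holds (p : nat) (V : finType) (d : condition p V) (w : V -> 'F_p)
    : bool :=
  match d with
  | PolyEq e => e.@[fun i => w (enum_val i)] == 0
  | Lookup vs T => map w vs \in T
  | VarEq x y => w x == w y
  end.

Record constraint (p : nat) (V : finType) : Type := Constraint {
  cond : condition p V;
  vars : {set V};
  cond_local : forall w1 w2 : V -> 'F_p,
    (forall v, v \in vars -> w1 v = w2 v) -> holds cond w1 = holds cond w2
}.

(* A finite constraint system is a family [cs] indexed by a finite type [C], so
   that its sets of constraints are the [Gamma : {set C}]. *)
Definition models (p : nat) (V C : finType) (cs : C -> constraint p V)
    (w : V -> 'F_p) (Gamma : {set C}) : Prop :=
  forall c, c \in Gamma -> holds (cond (cs c)) w.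

Definition entails (p : nat) (V C : finType) (cs : C -> constraint p V)
    (Gamma Phi : {set C}) : Prop :=
  forall w : V -> 'F_p, models cs w Gamma -> models cs w Phi.

Definition safe_debloating (p : nat) (V C : finType) (cs : C -> constraint p V)
    (R : {set C}) : Prop :=
  entails cs (~: R) R.

Definition srep (p : nat) (x : 'F_p) : int :=
  if (x <= p.-1./2)%N then (x : nat)%:Z else (x : nat)%:Z - p%:Z.

(* Two's complement: [divz] by a positive number rounds downwards. *)
Definition int_bit (z : int) (i : nat) : bool :=
  ((z %/ 2 ^+ i)%Z %% 2)%Z == 1.

Section AbstractValues.
Variables (p n : nat).

(* [None] is the top element. *)
Definition const_dom : Type := option 'F_p.
Definition itv_dom : Type := (int * int)%type.
(* Known bits for words of [n] bits: the mask m has m_i = 1 iff the entry at i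
   is [Some b_i]. *)
Definition bits_dom : Type := {ffun 'I_n -> option bool}.

(* [None] is the common bottom element, to which the reduction collapses all
   inconsistent triples. *)
Definition raw_aval := option (const_dom * itv_dom * bits_dom)%type.

Definition gamma_const (c : const_dom) : {set 'F_p} :=
  if c is Some a then [set a] else setT.
Definition gamma_itv (b : itv_dom) : {set 'F_p} :=
  [set x | b.1 <= srep x <= b.2].
Definition gamma_bits (k : bits_dom) : {set 'F_p} :=
  [set x | [forall i, if k i is Some b then int_bit (srep x) i == b else true]].

Definition gamma_raw (a : raw_aval) : {set 'F_p} :=
  if a is Some (c, b, k) then gamma_const c :&: gamma_itv b :&: gamma_bits k
  else set0.

Definition le_const (c1 c2 : const_dom) : bool := (c2 == None) || (c1 == c2).
Definition le_itv (b1 b2 : itv_dom) : bool := (b2.1 <= b1.1) && (b1.2 <= b2.2).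
Definition le_bits (k1 k2 : bits_dom) : bool :=
  [forall i, (k2 i == None) || (k1 i == k2 i)].

Definition le_raw (a1 a2 : raw_aval) : bool :=
  match a1, a2 with
  | None, _ => true
  | Some _, None => false
  | Some (c1, b1, k1), Some (c2, b2, k2) =>
      [&& le_const c1 c2, le_itv b1 b2 & le_bits k1 k2]
  end.

(* Best abstraction of a set of field elements, see [alpha_least]. *)
Definition alpha_raw (S : {set 'F_p}) : raw_aval :=
  if [pick x in S] is Some x0 then
    Some (if S == [set x0] then Some x0 else None,
          (srep [arg min_(x < x0 in S) srep x]%O,
           srep [arg max_(x > x0 in S) srep x]%O),
          [ffun i : 'I_n =>
             if [forall x in S, int_bit (srep x) i] then Some true
             else if [forall x in S, ~~ int_bit (srep x) i] then Some false
             else None])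
  else None.

Lemma alpha_raw_sound (S : {set 'F_p}) : S \subset gamma_raw (alpha_raw S).
Proof.
apply/subsetP=> x xS; rewrite /alpha_raw.
case: pickP => [x0 x0S|/(_ x)]; last by rewrite xS.
rewrite /= !inE -andbA; apply/and3P; split.
- by rewrite /gamma_const; case: eqP => [<-|]; rewrite ?inE.
- case: arg_minP => // y _ miny; case: arg_maxP => // z _ maxz.
  by apply/andP; split; [exact: miny|exact: maxz].
- apply/forallP=> i; rewrite ffunE.
  case: ifP => [/forall_inP/(_ x xS) ->//|_].
  by case: ifP => [/forall_inP/(_ x xS) /negbTE ->|].
Qed.

Lemma alpha_raw_least (S : {set 'F_p}) (a : raw_aval) :
  S \subset gamma_raw a -> le_raw (alpha_raw S) a.
Proof.
rewrite /alpha_raw; case: pickP => [x0 x0S|//].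
case: a => [[[c b] k]|]; last by move/subsetP/(_ x0 x0S); rewrite inE.
move=> /subsetP sub; rewrite /=.
have {}sub x : x \in S ->
    [/\ x \in gamma_const c, b.1 <= srep x <= b.2 & x \in gamma_bits k].
  by move=> /sub; rewrite /= 2!inE => /andP[/andP[-> ]]; rewrite inE => -> ->.
apply/and3P; split.
- case: c sub => [a|//] sub; rewrite /le_const /=.
  have Sa x : x \in S -> x = a by move=> /sub[]; rewrite inE => /eqP.
  have x0a := Sa x0 x0S; rewrite x0a in x0S *.
  suff -> : S == [set a] by rewrite eqxx.
  apply/eqP/setP=> x; rewrite inE; apply/idP/eqP => [/Sa//|->//].
- rewrite /le_itv /=; case: arg_minP => // y /sub[_ /andP[-> _] _] _.
  by case: arg_maxP => // z /sub[_ /andP[_ ->] _] _.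
- apply/forallP=> i; rewrite ffunE.
  have kb x : x \in S -> forall b', k i = Some b' -> int_bit (srep x) i = b'.
    move=> /sub[_ _]; rewrite inE => /forallP/(_ i) + b' kE.
    by rewrite kE => /eqP.
  case kE: (k i) => [[]|//] /=.
    by case: ifP => // /negP[]; apply/forall_inP=> x xS; rewrite (kb x xS _ kE).
  case: ifP => [/forall_inP/(_ x0 x0S)|_]; first by rewrite (kb x0 x0S _ kE).
  by case: ifP => // /negP[]; apply/forall_inP=> x xS; rewrite (kb x xS _ kE).
Qed.

Lemma le_raw_anti (a1 a2 : raw_aval) : le_raw a1 a2 -> le_raw a2 a1 -> a1 = a2.
Proof.
case: a1 a2 => [[[c1 b1] k1]|] [[[c2 b2] k2]|] //=.
move=> /and3P[c12 /andP[l12 u12] /forallP k12].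
move=> /and3P[c21 /andP[l21 u21] /forallP k21].
congr (Some (_, _, _)).
- by case/orP: c12 => /eqP // c2E; case/orP: c21 => /eqP // ->.
- case: b1 b2 l12 u12 l21 u21 => [l1 u1] [l2 u2] /= l12 u12 l21 u21.
  by congr (_, _); apply/le_anti/andP; split.
- apply/ffunP=> i; case/orP: (k12 i) => /eqP // k2E.
  by case/orP: (k21 i) => /eqP // ->.
Qed.

Lemma alpha_raw_reduced (S : {set 'F_p}) :
  alpha_raw (gamma_raw (alpha_raw S)) == alpha_raw S.
Proof.
apply/eqP/le_raw_anti; apply: alpha_raw_least => //.
exact: subset_trans (alpha_raw_sound S) (alpha_raw_sound _).
Qed.

(* Reduced product: the components are the tightest ones for the set that they
   jointly describe. *)
Record aval : Type := AVal {
  aval_raw : raw_aval;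
  aval_reduced : alpha_raw (gamma_raw aval_raw) == aval_raw
}.
HB.instance Definition _ := [isSub for aval_raw].
HB.instance Definition _ := [Equality of aval by <:].

Definition gamma (a : aval) : {set 'F_p} := gamma_raw (aval_raw a).
Definition le_aval (a1 a2 : aval) : bool :=
  le_raw (aval_raw a1) (aval_raw a2).

Definition alpha (S : {set 'F_p}) : aval := AVal (alpha_raw_reduced S).
Definition atop : aval := alpha setT.

Lemma alpha_sound (S : {set 'F_p}) : S \subset gamma (alpha S).
Proof. exact: alpha_raw_sound. Qed.

Lemma alpha_least (S : {set 'F_p}) (a : aval) :
  S \subset gamma a -> le_aval (alpha S) a.
Proof. exact: alpha_raw_least. Qed.

Lemma le_aval_gamma (a1 a2 : aval) :
  le_aval a1 a2 = (gamma a1 \subset gamma a2).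
Proof.
apply/idP/idP => [|sub]; last first.
  have := alpha_least sub; rewrite /le_aval /alpha /=.
  by rewrite (eqP (aval_reduced a1)).
rewrite /le_aval /gamma.
case: (aval_raw a1) (aval_raw a2) => [[[c1 b1] k1]|] [[[c2 b2] k2]|] //=;
  last by rewrite sub0set.
move=> /and3P[c12 /andP[l12 u12] /forallP k12].
apply: setISS; first apply: setISS.
- by case/orP: c12 => /eqP ->; rewrite ?subsetT.
- apply/subsetP=> x; rewrite !inE => /andP[lx xu].
  by rewrite (le_trans l12) // (le_trans xu).
- apply/subsetP=> x; rewrite !inE => /forallP kx; apply/forallP=> i.
  by case/orP: (k12 i) (kx i) => /eqP ->.
Qed.

Lemma le_atop (a : aval) : le_aval a atop.
Proof.
by rewrite le_aval_gamma (subset_trans (subsetT _)) ?alpha_sound.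
Qed.

End AbstractValues.

Section Analysis.
Variables (p n : nat) (V C : finType).

Definition state := {ffun V -> aval p n}.

Definition le_state (s1 s2 : state) : Prop :=
  forall v, le_aval (s1 v) (s2 v).

Definition overapprox (s : state) (w : V -> 'F_p) : Prop :=
  forall v, w v \in gamma (s v).

Definition set_state (s : state) (v : V) (a : aval p n) : state :=
  [ffun u => if u == v then a else s u].

Variables (cs : C -> constraint p V) (transfer : C -> state -> state).

Definition monotone_transfer (c : C) : Prop :=
  forall s1 s2 : state,
    le_state s1 s2 -> le_state (transfer c s1) (transfer c s2).

Definition locally_sound (c : C) : Prop :=
  forall (w : V -> 'F_p) (s : state),
    holds (cond (cs c)) w -> overapprox s w -> overapprox (transfer c s) w.

(* [pin v = Some a]: the variable v is pinned to the circuit constant a. *)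
Definition init_state (pin : V -> option 'F_p) : state :=
  [ffun v => if pin v is Some a then alpha n [set a] else atop p n].

(* The order in which the transfer functions are applied is arbitrary. *)
Definition analysis_fixpoint (pin : V -> option 'F_p) (s : state) : Prop :=
  (exists r : seq C,
     s = foldl (fun s' c => transfer c s') (init_state pin) r) /\
  (forall c, transfer c s = s).

End Analysis.

Inductive kind : Type := Lo | Hi | Bits.

Definition kind_code (k : kind) : option bool :=
  match k with Lo => Some false | Hi => Some true | Bits => None end.
Definition kind_decode (o : option bool) : kind :=
  match o with Some false => Lo | Some true => Hi | None => Bits end.
Lemma kind_codeK : cancel kind_code kind_decode.
Proof. by case. Qed.
HB.instance Definition _ := Finite.copy kind (can_type kind_codeK).

Notation fact V := (V * kind)%type.
Notation node V C := (C * (V * kind) * {set (V * kind)})%type.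

Section Provenance.
Variables (p n : nat) (V C : finType).
Variables (cs : C -> constraint p V) (transfer : C -> state p n V -> state p n V).
Variable (sstar : state p n V).

(* The field elements that satisfy the atom recorded by [sstar]; the atoms
   recorded by bottom are unsatisfiable. *)
Definition atom (f : fact V) : {set 'F_p} :=
  if aval_raw (sstar f.1) is Some (_, b, k) then
    match f.2 with
    | Lo => [set x | b.1 <= srep x]
    | Hi => [set x | srep x <= b.2]
    | Bits => gamma_bits p k
    end
  else set0.

Definition sat_fact (w : V -> 'F_p) (f : fact V) : Prop := w f.1 \in atom f.

Definition forces (s : state p n V) (f : fact V) : bool :=
  gamma (s f.1) \subset atom f.

Definition facts : {set fact V} := [set f | forces sstar f].

(* By [alpha_sound] and [alpha_least], [alpha] yields the narrowest value. *)
Definition state_of (v : V) (S : {set fact V}) : state p n V :=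
  [ffun u => if u == v then atop p n
             else alpha n (\bigcap_(f in S | f.1 == u) atom f)].

Definition all_premises (c : C) (v : V) : {set fact V} :=
  [set f in facts | f.1 \in vars (cs c) :\ v].

Definition justifies (c : C) (f : fact V) (P : {set fact V}) : bool :=
  forces (transfer c (state_of f.1 P)) f.

Inductive drops (Q : pred {set fact V}) (P : {set fact V}) :
    {set fact V} -> Prop :=
| drops_refl : drops Q P P
| drops_step q P' :
    q \in P -> Q (P :\ q) -> drops Q (P :\ q) P' -> drops Q P P'.

Definition premise_set (c : C) (f : fact V) (P : {set fact V}) : Prop :=
  [/\ drops (justifies c f) (all_premises c f.1) P,
      justifies c f P
    & forall q, q \in P -> ~~ justifies c f (P :\ q)].

Definition triggers (c : C) (f : fact V) : bool :=
  (f.1 \in vars (cs c)) &&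
  forces (transfer c (set_state sstar f.1 (atop p n))) f.

(* The generation procedure leaves open which facts are dropped first; [N] is
   any of its outcomes. *)
Definition provenance_nodes (N : {set node V C}) : Prop :=
  (forall c f P, (c, f, P) \in N ->
     [/\ triggers c f, f \in facts & premise_set c f P]) /\
  (forall c f, triggers c f -> exists! P, (c, f, P) \in N).

End Provenance.

Section Provability.
Variables (V C : finType) (N : {set node V C}).

Inductive provable (M : {set node V C}) : fact V -> Prop :=
| provable_fact c f P : provable_node M (c, f, P) -> provable M f
with provable_node (M : {set node V C}) : node V C -> Prop :=
| provable_node_intro c f P :
    (c, f, P) \in N :\: M -> (forall q, q \in P -> provable M q) ->
    provable_node M (c, f, P).

Definition mask_of (R : {set C}) : {set node V C} :=
  [set nu in N | nu.1.1 \in R].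

Definition provenance_grounded (entailed : pred C) (Obl : C -> {set fact V})
    (R : {set C}) : Prop :=
  exists (k : nat) (s : k.-tuple C),
    [/\ uniq s, R = [set c in s]
      & forall i : 'I_k,
          entailed (tnth s i) /\
          (forall f, f \in Obl (tnth s i) ->
             provable (mask_of [set tnth s j | j : 'I_k & (j <= i)%N]) f)].

End Provability.

Definition entailment_sound (p n : nat) (V C : finType)
    (cs : C -> constraint p V) (sstar : state p n V)
    (entailed : pred C) (Obl : C -> {set fact V}) : Prop :=
  forall c, entailed c -> forall w : V -> 'F_p,
    (forall f, f \in Obl c -> sat_fact sstar w f) -> holds (cond (cs c)) w.

(* Main.v *)
(* Let [R_m] consist of the first [m] constraints removed.  By local soundness,
   a witness of the constraints outside [R_m] satisfies every fact provable under
   the mask of [R_m]; in particular it satisfies the obligations of the [m]-th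
   constraint, hence that constraint, and so is a witness of the constraints
   outside [R_(m-1)].  Descending from [R] to the empty set gives the theorem. *)
Require Import Defs.
From mathcomp Require Import all_boot all_order all_algebra.

Scheme provable_mutual_ind := Minimality for provable Sort Prop
  with provable_node_mutual_ind := Minimality for provable_node Sort Prop.

Lemma overapprox_state_of (p n : nat) (V : finType) (sstar : state p n V)
    (w : V -> 'F_p) (v : V) (P : {set fact V}) :
  (forall q, q \in P -> sat_fact sstar w q) ->
  overapprox (state_of sstar v P) w.
Proof.
move=> wP u; rewrite ffunE; case: eqP => _; apply: (subsetP (alpha_sound _ _)).
  by rewrite inE.
by apply/bigcapP => q /andP[/wP + /eqP <-].
Qed.

(** Induction on the derivation: an unmasked node has its constraint outside [R], so [w] satisfies
    that constraint. The premises hold by induction, so [state_of] over-approximates [w], and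
    [justifies] carries this over to the target. *)
Lemma provable_sat (p n : nat) (V C : finType) (cs : C -> constraint p V)
    (transfer : C -> state p n V -> state p n V) (sstar : state p n V)
    (N : {set node V C}) (R : {set C}) (w : V -> 'F_p) :
  (forall c, locally_sound cs transfer c) ->
  provenance_nodes cs transfer sstar N ->
  models cs w (~: R) ->
  forall f, provable N (mask_of N R) f -> sat_fact sstar w f.
Proof.
move=> sound [Nprem _] wR.
apply: (@provable_mutual_ind V C N (mask_of N R) (sat_fact sstar w)
          (fun nu => sat_fact sstar w nu.1.2)) => // c f P.
rewrite !inE /= negb_and => /andP[+ cfP _ wP]; rewrite cfP /= => cR.
have [_ _ [_ just _]] := Nprem _ _ _ cfP.
apply: (subsetP just); apply: sound (overapprox_state_of _ _ _ _ _ _ _ wP) _.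
by apply: wR; rewrite inE.
Qed.

Lemma grounded_safe (p n : nat) (V C : finType) (cs : C -> constraint p V)
    (transfer : C -> state p n V -> state p n V) (sstar : state p n V)
    (N : {set node V C}) (entailed : pred C) (Obl : C -> {set fact V})
    (R : {set C}) (w : V -> 'F_p) :
  (forall c, locally_sound cs transfer c) ->
  provenance_nodes cs transfer sstar N ->
  entailment_sound cs sstar entailed Obl ->
  provenance_grounded N entailed Obl R ->
  models cs w (~: R) -> models cs w [set: C].
Proof.
move=> sound nodes ent [k [s [_ -> grounded]]] wR.
(* Here [d] counts the constraints already put back, from the end of the ordering. *)
have wRm d : d <= k -> models cs w (~: [set tnth s j | j : 'I_k & j < k - d]).
  elim: d => [_|d IHd dk] c; rewrite inE => cR.
    apply: wR; rewrite !inE; apply: contra cR => /tnthP[j ->].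
    by apply: imset_f; rewrite inE subn0.
  have mk : k - d.+1 < k by rewrite -subn_gt0 subKn.
  (* [m] is the last index still removed, the one to put back now. *)
  pose m := Ordinal mk; have mE : k - d = m.+1 by rewrite -subSn.
  have wm := IHd (ltnW dk); rewrite mE in wm.
  case: (eqVneq c (tnth s m)) => [->|c_m].
    have [em obl] := grounded m.
    (* The set masked in [obl] is the one removed in [wm]: [j <= m] and [j < m.+1] are
       convertible. *)
    apply: (ent _ em) => f /obl; exact: provable_sat sound nodes wm f.
  apply: wm; rewrite inE; apply: contra cR => /imsetP[j].
  rewrite inE ltnS leq_eqVlt => /orP[/eqP/val_inj ->|jm] cE.
    by rewrite cE eqxx in c_m.
  by rewrite cE; apply: imset_f; rewrite inE.
(* At [d = k] nothing is removed any more. *)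
move=> c _; apply: (wRm k (leqnn k)); rewrite subnn inE.
by apply/imsetP => -[j]; rewrite inE ltn0.
Qed.

Theorem theorem4p3 (p : nat) (hp : prime p) (hodd : odd p) (n : nat)
    (V C : finType) (cs : C -> constraint p V)
    (pin : V -> option 'F_p)
    (transfer : C -> state p n V -> state p n V)
    (hmono : forall c, monotone_transfer transfer c)
    (hsound : forall c, locally_sound cs transfer c)
    (sstar : state p n V) (hstar : analysis_fixpoint transfer pin sstar)
    (N : {set node V C}) (hN : provenance_nodes cs transfer sstar N)
    (entailed : pred C) (Obl : C -> {set fact V})
    (hObl : forall c, entailed c -> Obl c \subset facts sstar)
    (hent : entailment_sound cs sstar entailed Obl)
    (R : {set C}) (hR : provenance_grounded N entailed Obl R) :
  safe_debloating cs R /\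
  (forall w : V -> 'F_p, models cs w (~: R) <-> models cs w [set: C]).
Proof.
have safe w := grounded_safe _ _ _ _ _ _ _ _ _ _ _ w hsound hN hent hR.
split=> [w wR c _|w]; first by apply: safe wR _ _; rewrite inE.
by split=> [/safe //|wC c _]; apply: wC; rewrite inE.
Qed.
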